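(* Let $\Sigma$ be a finite alphabet and let $X=(\{s\},W,\mu_R,\mu_W,\sigma)$ be a star-like PFA over $\Sigma$ in canonical form such that $\mu_R(s,a,s)<1$ for all $a\in\Sigma$. Then the following are equivalent: (1) for all $a,b\in\Sigma$: $\mu_R(s,a,s)+\sum_{q\in W}\mu_R(s,a,q)\cdot\bigl(\mu_W(q,b,q)+\mu_W(q,b,s)\bigr)<1$; (2) $H(\Sigma^\omega,n,X)\in O(\log n)$ (as $n\to\infty$).
   Context: $\Sigma$ is a finite alphabet; $\Sigma^\omega$, $\Sigma^*$ denote the infinite and the finite strings over $\Sigma$, and $\Sigma^\infty=\Sigma^*\cup\Sigma^\omega$. For strings $u,v$, $\mathrm{lcp}(u,v)$ is the length of their longest common prefix. A (Mealy-type) probabilistic finite automaton (PFA) over $\Sigma$ is a tuple $X=(R,W,\mu_R,\mu_W,\sigma)$ with a nonempty finite set $R$ of input states, a nonempty finite set $W$ of output states, functions $\mu_R:R\times\Sigma\times(R\cup W)\to[0,1]$ and $\mu_W:W\times\Sigma\times(R\cup W)\to[0,1]$ with $\sum_{p}\mu_R(q,a,p)=1$ for all $q\in R,a\in\Sigma$ and $\sum_{a}\sum_{p}\mu_W(q,a,p)=1$ for all $q\in W$, and an initial distribution $\sigma$ on $R\cup W$. Semantics: in an input state $q$, reading symbol $a$ the PFA moves to $p$ with probability $\mu_R(q,a,p)$; in an output state $q$, with probability $\mu_W(q,a,p)$ it writes $a$ and moves to $p$. The computation on one input symbol starts in an input state and ends when an input state is reached again; its output is the concatenation of written symbols. The computation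 on a string $t$ is the concatenation of the computations on $t[1],t[2],\dots$, each starting in the input state where the previous one ended; $X(t)$ is the (random) output, so $X$ is a random map $\Sigma^\omega\to\Sigma^\infty$. $X$ is star-like if $R=\{s\}$, $\mu_W(q,a,q')=0$ for all distinct $q,q'\in W$ and all $a$, and $\sum_{a\in\Sigma}\mu_W(q,a,q)<1$ for every $q\in W$. $X$ is in canonical form if $\sigma(s)=1$. Smoothed trie height: for nonempty $S\subseteq\Sigma^\omega$ and $n$, $H(S,n,X)=\max_{A\subseteq S,\,|A|=n}\mathbb{E}\bigl[\max_{u,v\in A}\mathrm{lcp}(X(u),X(v))\bigr]$, where distinct strings are perturbed independently. *)

(* Defs.v *)
From HB Require Import structures.
From mathcomp Require Export all_boot all_order all_algebra finmap.
From mathcomp Require Export all_classical all_reals all_analysis.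
Set Implicit Arguments.
Unset Strict Implicit.
Unset Printing Implicit Defensive.
Import Order.TTheory GRing.Theory Num.Theory.
Local Open Scope classical_set_scope.
Local Open Scope ring_scope.

Definition iword (Sigma : finType) : Type := nat -> Sigma.

(* Finite or infinite strings: [letter x i] is the symbol of [x] at position
   [i] (counted from 0), [None] past the end of [x]. *)
Record fiword (Sigma : finType) := FIWord {
  letter :> nat -> option Sigma;
  letter_closed : forall i, letter i = None -> letter i.+1 = None }.

(* Extended-real valued: [+oo] when [x] and [y] are infinite and equal. *)
Definition lcp (R : realType) (Sigma : finType) (x y : fiword Sigma) : \bar R :=
  ereal_sup [set k%:R%:E | k in
    [set k : nat | forall i, (i < k)%N -> x i <> None /\ x i = y i]].

(* [o k] is what is written at time [k] ([None]: nothing). *)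
Definition written (Sigma : finType) (o : nat -> option Sigma) (k : nat) :
  seq Sigma := pmap o (iota 0 k).

(* The values [onth (written o k) i] different from [None] agree for all [k],
   since [written o k] is a prefix of [written o k.+1]. *)
Definition output_letter (Sigma : finType) (o : nat -> option Sigma) (i : nat) :
  option Sigma :=
  xget None [set Some a | a in
    [set a : Sigma | exists k, onth (written o k) i = Some a]].

Lemma output_closed (Sigma : finType) (o : nat -> option Sigma) (i : nat) :
  output_letter o i = None -> output_letter o i.+1 = None.
Proof.
rewrite /output_letter.
case: xgetP => [x _ [a _ <-] //|none _].
case: xgetP => [x _ [a [k ka] _]|//]; exfalso.
move: (none (onth (written o k) i)); apply.
case E : (onth (written o k) i) => [b|]; first by exists b => //; exists k.
have := onthNE (written o k) i; rewrite E /= => /esym le_k.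
by rewrite onth_default ?leqW in ka.
Qed.

Definition output (Sigma : finType) (o : nat -> option Sigma) : fiword Sigma :=
  FIWord (@output_closed Sigma o).

Record pfa (R : realType) (Sigma : finType) := PFA {
  istate : finType;
  ostate : finType;
  muR : istate -> Sigma -> istate + ostate -> R;
  muW : ostate -> Sigma -> istate + ostate -> R;
  init : istate + ostate -> R;
  istate_neq0 : (0 < #|istate|)%N;
  ostate_neq0 : (0 < #|ostate|)%N;
  muR_itv : forall q a p, 0 <= muR q a p <= 1;
  muW_itv : forall q a p, 0 <= muW q a p <= 1;
  init_itv : forall p, 0 <= init p <= 1;
  muR_sum : forall q a, \sum_p muR q a p = 1;
  muW_sum : forall q, \sum_a \sum_p muW q a p = 1;
  init_sum : \sum_p init p = 1 }.

Arguments init {R Sigma} _ _.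

Section PFA.
Context (R : realType) (Sigma : finType) (X : pfa R Sigma).

Definition state : Type := (istate X + ostate X)%type.

Definition star_like (s : istate X) : Prop :=
  [/\ forall q : istate X, q = s,
      forall q q' : ostate X, q != q' -> forall a, muW q a (inr q') = 0
    & forall q : ostate X, \sum_a muW q a (inr q) < 1].

Definition canonical_form (s : istate X) : Prop := init X (inl s) = 1.

(* Probability to write [o] ([None]: nothing) and move to [p] from [q], when
   the next symbol of the input is [a]. *)
Definition step_prob (a : Sigma) (q : state) (o : option Sigma) (p : state) : R :=
  match q, o with
  | inl q, None => muR q a p
  | inr q, Some b => muW q b p
  | _, _ => 0
  end.

(* Probability that the computation on [t], started in [q], begins with the
   steps [r]; a step records what is written and the state it leads to.
   Only steps from input states consume a symbol of [t]. *)
Fixpoint steps_prob (t : iword Sigma) (q : state)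
    (r : seq (option Sigma * state)) : R :=
  if r is (o, p) :: r' then
    step_prob (t 0) q o p *
    steps_prob (if q is inl _ then fun i => t i.+1 else t) p r'
  else 1.

(* A complete computation: its initial state and its infinite sequence of
   steps. *)
Definition run : Type := (state * (nat -> option Sigma * state))%type.

Definition run_output (rho : run) : fiword Sigma :=
  output (fun k => (rho.2 k).1).

Definition cylinder (q : state) (r : seq (option Sigma * state)) : set run :=
  [set rho : run | rho.1 = q /\ mkseq rho.2 (size r) = r].

(* [Y t w] is the computation of [X] on [t] under the random outcome [w], and
   the computations on distinct strings are mutually independent.  All
   coordinates of a run take finitely many values, so the laws and the
   independence are determined by the cylinders. *)
Definition random_runs d (T : measurableType d) (P : probability T R)
    (Y : iword Sigma -> T -> run) : Prop :=
  [/\ forall t q r, measurable (Y t @^-1` cylinder q r),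
      forall t q r,
        P (Y t @^-1` cylinder q r) = (init X q * steps_prob t q r)%:E
    & forall (A : {fset iword Sigma}) (q : iword Sigma -> state)
             (r : iword Sigma -> seq (option Sigma * state)),
        P (\bigcap_(t in [set` A]) (Y t @^-1` cylinder (q t) (r t))) =
        (\prod_(t <- A) P (Y t @^-1` cylinder (q t) (r t)))%E].

(* The supremum over the [n]-element subsets of [S] is [-oo] if there are
   none. *)
Definition smoothed_height d (T : measurableType d) (P : probability T R)
    (Y : iword Sigma -> T -> run) (S : set (iword Sigma)) (n : nat) : \bar R :=
  ereal_sup [set
    (\int[P]_w \big[maxe/0]_(u <- A) \big[maxe/0]_(v <- A | v != u)
       lcp R (run_output (Y u w)) (run_output (Y v w)))%E
    | A in [set A : {fset iword Sigma} |
             [set` A] `<=` S /\ #|` A|%fset = n]].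

End PFA.

(* The absolute value excludes [-oo] as well as [+oo] for large [n]. *)
Definition is_O_log (R : realType) (f : nat -> \bar R) : Prop :=
  exists C : R, \forall n \near \oo, (`|f n| <= (C * ln n%:R)%:E)%E.

(* Main.v *)
(* Condition (1) says that, whatever symbol [a] is read, the first symbol
   written in response is not almost surely a fixed [b] (given that something is
   written).

   If (1) holds, the probability that the output on a string [t] starts with a
   word [w] decays like [rho ^ |w|], uniformly in [t] and [w]: an output state
   writes a symbol without returning to [s] with probability bounded away from
   1, and from [s] the next symbol of [w] is missed with probability bounded
   away from 0.  For distinct [u] and [v], conditioning on the output on [u] and
   using independence, the common prefix has length at least [k] with
   probability at most [rho ^ (k - 1)], and a union bound over the pairs, cut at
   [k = 2 ln n / ln (1 / rho)], gives the logarithmic height.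

   If (1) fails for [a] and [b], the output on [a ^ m] consists of [b]s only,
   more and more of them as [m] grows; strings sharing the prefix [a ^ m] then
   have perturbations with arbitrarily long common prefixes, and the height is
   infinite. *)
Require Import Defs.
From mathcomp Require Import all_boot all_order all_algebra finmap.
From mathcomp Require Import all_classical all_reals all_analysis.
From mathcomp Require Import ring lra measurable_realfun.
Set Implicit Arguments.
Unset Strict Implicit.
Unset Printing Implicit Defensive.
Import Order.TTheory GRing.Theory Num.Theory.
Local Open Scope classical_set_scope.
Local Open Scope ring_scope.

(** * Finite sums and maxima *)

Lemma sum_tuple_cons (V : nmodType) (I : finType) m (B : pred (seq I))
    (F : seq I -> V) :
  \sum_(r : m.+1.-tuple I | B r) F r =
  \sum_x \sum_(r : m.-tuple I | B (x :: r)) F (x :: r).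
Proof.
rewrite pair_big_dep /=.
rewrite (reindex (fun p : I * m.-tuple I => [tuple of p.1 :: p.2])) //=.
exists (fun r => (thead r, behead_tuple r)) => [[x r] _|r _] /=.
  by rewrite theadE; congr (_, _); apply: val_inj.
by rewrite [RHS]tuple_eta; apply: val_inj.
Qed.

(** Starting the maximum at 0 makes [r] nonnegative and covers an empty [I]. *)
Lemma lt1_uniform (R : realType) (I : finType) (F : I -> R) :
  (forall i, F i < 1) -> exists2 r, 0 <= r < 1 & forall i, F i <= r.
Proof.
move=> F_lt1; exists (\big[Num.max/0]_i F i); last exact: le_bigmax.
by rewrite bigmax_ge_id; apply: bigmax_lt.
Qed.

(** * Law of the word written in finitely many steps *)

Section Steps.
Context (R : realType) (Sigma : finType) (X : pfa R Sigma).
Implicit Types (t : iword Sigma) (q : state X) (B : pred (seq Sigma)).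

(** [m] counts steps, not symbols: steps from input states write nothing and vanish under
    [pmap fst]. *)
Definition written_prob t q m B : R :=
  \sum_(r : m.-tuple (option Sigma * state X) | B (pmap fst r))
    steps_prob t q r.

Lemma muR_ge0 (q : istate X) a p : 0 <= muR q a p.
Proof. by case/andP: (muR_itv q a p). Qed.

Lemma muW_ge0 (q : ostate X) a p : 0 <= muW q a p.
Proof. by case/andP: (muW_itv q a p). Qed.

Lemma steps_prob_ge0 t q r : 0 <= steps_prob t q r.
Proof.
elim: r t q => [|[y p] r IH] t q //=; apply: mulr_ge0 => //.
by case: q y => [q|q] [b|] //=; rewrite ?muR_ge0 ?muW_ge0.
Qed.

Lemma sum_step (V : nmodType) (F : option Sigma * state X -> V) :
  \sum_x F x = \sum_p F (None, p) + \sum_a \sum_p F (Some a, p).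
Proof.
rewrite (eq_bigr (fun x => F (x.1, x.2))) => [|[] //].
rewrite -(pair_bigA _ (fun y p => F (y, p))) /= (bigD1 None) //=; congr (_ + _).
rewrite (reindex_omap Some id) /=; first by apply: eq_bigl => a; rewrite eqxx.
by case.
Qed.

Lemma written_prob_istate t (q : istate X) m B :
  written_prob t (inl q) m.+1 B =
  \sum_p muR q (t 0%N) p * written_prob (fun i => t i.+1) p m B.
Proof.
rewrite /written_prob (sum_tuple_cons _ (fun r => B (pmap fst r))) sum_step /=.
rewrite [X in _ + X]big1 ?addr0 => [|a _].
  by apply: eq_bigr => p _; rewrite big_distrr.
by apply: big1 => p _; apply: big1 => r _; rewrite mul0r.
Qed.

Lemma written_prob_ostate t (q : ostate X) m B :
  written_prob t (inr q) m.+1 B =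
  \sum_a \sum_p muW q a p * written_prob t p m (fun w => B (a :: w)).
Proof.
rewrite /written_prob (sum_tuple_cons _ (fun r => B (pmap fst r))) sum_step /=.
rewrite [X in X + _]big1 ?add0r => [|p _].
  by apply: eq_bigr => a _; apply: eq_bigr => p _; rewrite big_distrr.
by apply: big1 => r _; rewrite mul0r.
Qed.

Lemma written_prob0 t q B : written_prob t q 0 B = (B [::])%:R.
Proof.
rewrite /written_prob (eq_bigr (fun=> 1)) => [|r _]; last by rewrite tuple0.
rewrite (eq_bigl (fun=> B [::])) => [|r]; last by rewrite tuple0.
by case: (B [::]); [rewrite sumr_const card_tuple | rewrite big_pred0_eq].
Qed.

Lemma written_probT t q m : written_prob t q m predT = 1.
Proof.
elim: m t q => [|m IH] t q; first by rewrite written_prob0.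
case: q => q; rewrite ?written_prob_istate ?written_prob_ostate.
  by rewrite -[RHS](muR_sum q (t 0%N)); apply: eq_bigr => p _; rewrite IH mulr1.
rewrite -[RHS](muW_sum q); apply: eq_bigr => a _; apply: eq_bigr => p _.
by rewrite (IH t p : written_prob t p m (fun w => predT (a :: w)) = 1) mulr1.
Qed.

Lemma written_prob_eq t q m B B' : B =1 B' ->
  written_prob t q m B = written_prob t q m B'.
Proof. by move=> eqB; apply: eq_bigl => r; exact: eqB. Qed.

Lemma written_prob_prefix_ostate t (q : ostate X) m b w :
  written_prob t (inr q) m.+1 (prefix (b :: w)) =
  \sum_p muW q b p * written_prob t p m (prefix w).
Proof.
rewrite written_prob_ostate (bigD1 b) //= [X in _ + X]big1 ?addr0 => [|a neq_ab].
  apply: eq_bigr => p _; congr (_ * _).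
  by apply: written_prob_eq => v /=; rewrite eqxx.
apply: big1 => p _; rewrite (@written_prob_eq _ _ _ _ pred0) => [|v].
  by rewrite /written_prob big_pred0 ?mulr0.
by rewrite /= eq_sym (negPf neq_ab).
Qed.

End Steps.

(** * Star-like automata: decay under (1), concentration without it *)

Section StarLike.
Context (R : realType) (Sigma : finType) (X : pfa R Sigma) (s : istate X).
Context (X_star : star_like s).

Lemma sum_state (F : state X -> R) :
  \sum_p F p = F (inl s) + \sum_q F (inr q).
Proof.
have [eq_s _ _] := X_star.
rewrite big_sumType /=; congr (_ + _); rewrite (bigD1 s) //= big1 ?addr0 // => q.
by rewrite (eq_s q) eqxx.
Qed.

Lemma sum_muW (q : ostate X) a (F : state X -> R) :
  \sum_p muW q a p * F p = muW q a (inl s) * F (inl s) + muW q a (inr q) * F (inr q).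
Proof.
have [_ no_jump _] := X_star.
rewrite sum_state; congr (_ + _); rewrite (bigD1 q) //= big1 ?addr0 // => q' neq.
by rewrite no_jump 1?eq_sym // mul0r.
Qed.

Lemma muR_split a : muR s a (inl s) + \sum_q muR s a (inr q) = 1.
Proof. by rewrite -[RHS](muR_sum s a) sum_state. Qed.

Lemma muW_split (q : ostate X) :
  \sum_a (muW q a (inl s) + muW q a (inr q)) = 1.
Proof.
rewrite -[RHS](muW_sum q); apply: eq_bigr => a _.
have := sum_muW q a (fun=> 1); rewrite !mulr1 => <-.
by apply: eq_bigr => p _; rewrite mulr1.
Qed.

Lemma muW_le1 (q : ostate X) a : muW q a (inl s) + muW q a (inr q) <= 1.
Proof.
rewrite -[X in _ <= X](muW_split q) (bigD1 a) //= lerDl.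
by apply: sumr_ge0 => b _; rewrite addr_ge0 ?muW_ge0.
Qed.

Implicit Types (t : iword Sigma) (a b : Sigma) (w : seq Sigma).

(** The sum in condition (1): the chance that the reading of [a] in [s] leads to an output that
    begins with [b]. *)
Definition first_letter_prob a b : R :=
  \sum_(q : ostate X) muR s a (inr q) * (muW q b (inr q) + muW q b (inl s)).

Lemma written_prob_prefix_nil t (q : state X) m :
  written_prob t q m (prefix (@nil Sigma)) = 1.
Proof.
rewrite -(written_probT t q m); apply: written_prob_eq => w.
by rewrite prefix0s.
Qed.

Lemma written_prob_star_istate t m B :
  written_prob t (inl s) m.+1 B =
  muR s (t 0%N) (inl s) * written_prob (fun i => t i.+1) (inl s) m B +
  \sum_q muR s (t 0%N) (inr q) * written_prob (fun i => t i.+1) (inr q) m B.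
Proof. by rewrite written_prob_istate sum_state. Qed.

Lemma written_prob_star_ostate t (q : ostate X) m b w :
  written_prob t (inr q) m.+1 (prefix (b :: w)) =
  muW q b (inl s) * written_prob t (inl s) m (prefix w) +
  muW q b (inr q) * written_prob t (inr q) m (prefix w).
Proof. by rewrite written_prob_prefix_ostate sum_muW. Qed.

(* [c] is the gain of being in [s], where missing the next symbol is possible at
   once.  The exponent in the second entry of the minimum is lower because an
   output state may be certain to write [b]. *)
Lemma written_prob_prefix_le (c rho rho0 eta : R) :
  0 <= c <= 1 -> 0 <= rho <= 1 -> 0 <= rho0 ->
  rho0 <= c * rho -> eta + (1 - eta) * c <= rho ->
  (forall a b, first_letter_prob a b <= rho0 * (1 - muR s a (inl s))) ->
  (forall (q : ostate X) b, muW q b (inr q) <= eta) ->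
  forall m t b w,
    written_prob t (inl s) m (prefix (b :: w)) <= c * rho ^+ size w /\
    forall q, written_prob t (inr q) m (prefix (b :: w)) <=
      Num.min (rho ^+ size w)
        ((muW q b (inr q) + muW q b (inl s)) * rho ^+ (size w).-1).
Proof.
move=> /andP[c0 c1] /andP[r0 r1] rho0_ge0 rho0_le eta_le write_le stay_le.
elim=> [|m IH] t b w.
  split=> [|q]; rewrite written_prob0 /=; first by rewrite mulr_ge0 ?exprn_ge0.
  by rewrite le_min exprn_ge0 // mulr_ge0 ?exprn_ge0 // addr_ge0 ?muW_ge0.
have IHs t' (v : seq Sigma) :
    written_prob t' (inl s) m (prefix v) <= rho ^+ (size v).-1.
  case: v => [|a v]; first by rewrite written_prob_prefix_nil.
  by have [+ _] := IH t' a v => /le_trans; apply; rewrite ler_piMl ?exprn_ge0.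
have IHq t' (q : ostate X) (v : seq Sigma) :
    written_prob t' (inr q) m (prefix v) <= rho ^+ (size v).-1.
  case: v => [|a v]; first by rewrite written_prob_prefix_nil.
  have [_ /(_ q)] := IH t' a v; rewrite le_min => /andP[+ _] => /le_trans; exact.
split=> [|q]; last rewrite le_min.
  rewrite written_prob_star_istate.
  set t' := fun i => t i.+1; set dl := muR s (t 0%N) (inl s).
  have dl_ge0 : 0 <= dl by exact: muR_ge0.
  have [les _] := IH t' b w.
  (* For the successors [q] the second entry of the minimum is used: its factor, averaged over [q],
     is [first_letter_prob]. *)
  apply: (@le_trans _ _ (dl * (c * rho ^+ size w) +
                         first_letter_prob (t 0%N) b * rho ^+ (size w).-1)).
    apply: lerD; first by rewrite ler_wpM2l.
    rewrite mulr_suml; apply: ler_sum => q _; rewrite -mulrA ler_wpM2l ?muR_ge0 //.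
    by have [_ /(_ q)] := IH t' b w; rewrite le_min => /andP[].
  have dl_le1 : dl <= 1 by case/andP: (muR_itv s (t 0%N) (inl s)).
  (* For empty [w] the predecessor is truncated, and [rho <= 1] replaces the missing factor. *)
  have le_last : rho0 * rho ^+ (size w).-1 <= c * rho ^+ size w.
    case: (size w) => [|k] /=; last by rewrite exprS mulrA ler_wpM2r ?exprn_ge0.
    by rewrite !expr0 !mulr1 (le_trans rho0_le) // ler_piMr.
  have := ler_wpM2r (exprn_ge0 (size w).-1 r0) (write_le (t 0%N) b).
  rewrite -/dl => /(lerD (lexx (dl * (c * rho ^+ size w)))) /le_trans; apply.
  have : 0 <= 1 - dl by rewrite subr_ge0.
  move=> /ler_wpM2l /(_ _ _ le_last); lra.
have W1 := muW_ge0 q b (inl s); have W2 := muW_ge0 q b (inr q).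
have W3 := muW_le1 q b.
rewrite written_prob_star_ostate; apply/andP; split; last first.
  rewrite addrC mulrDl; apply: lerD; rewrite ler_wpM2l //.
case: w => [|b' w] /=; first by rewrite !written_prob_prefix_nil !mulr1.
have [les /(_ q)] := IH t b' w; rewrite le_min => /andP[leq _].
(* After [b], a return to [s] gains [c] on the next symbol and a stay in [q] gains nothing. As
   [c <= 1], the worst case is a stay of probability [eta] and a return otherwise. *)
apply: (@le_trans _ _ ((muW q b (inl s) * c + muW q b (inr q)) * rho ^+ size w)).
  by rewrite mulrDl -mulrA; apply: lerD; rewrite ler_wpM2l.
rewrite exprS ler_wpM2r ?exprn_ge0 //; apply: le_trans eta_le.
have E1 := stay_le q b.
apply: (@le_trans _ _ ((1 - muW q b (inr q)) * c + muW q b (inr q))).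
  by rewrite lerD2r ler_wpM2r //; lra.
have : 0 <= (1 - c) * (eta - muW q b (inr q)) by rewrite mulr_ge0 ?subr_ge0.
lra.
Qed.

(** The parameters of the previous bound are chosen here. The exponent is one short since the first
    symbol yields only the factor [c], which is dropped. *)
Lemma written_prob_exp_decay :
  (forall a b, muR s a (inl s) + first_letter_prob a b < 1) ->
  exists2 rho, 0 < rho < 1 & forall t m w,
    written_prob t (inl s) m (prefix w) <= rho ^+ (size w).-1.
Proof.
move=> H.
have write_ge0 a b : 0 <= first_letter_prob a b.
  by apply: sumr_ge0 => q _; rewrite mulr_ge0 ?addr_ge0 ?muR_ge0 ?muW_ge0.
have del_lt1 a : 0 < 1 - muR s a (inl s).
  by have := H a a; have := write_ge0 a a; lra.
(* The quotient is the probability that the output on [a] begins with [b], given that [s] does not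
   delete [a]. *)
have [|rho0 /andP[rho0_ge0 rho0_lt1] rho0_le] :=
  @lt1_uniform R (Sigma * Sigma)%type
    (fun ab => first_letter_prob ab.1 ab.2 / (1 - muR s ab.1 (inl s))).
  by case=> a b /=; rewrite ltr_pdivrMr // mul1r; have := H a b; lra.
have [_ _ stay_lt1] := X_star.
have [eta /andP[eta_ge0 eta_lt1] eta_le] := lt1_uniform stay_lt1.
(* Any [c] strictly between [rho0] and 1 keeps both entries of the maximum [rho] below 1. *)
pose c := (1 + rho0) / 2.
have [c_gt0 c_lt1] : 0 < c /\ c < 1 by rewrite /c; split; lra.
pose rho := Num.max (rho0 / c) (eta + (1 - eta) * c).
have rho_gt0 : 0 < rho.
  rewrite lt_max; apply/orP; right.
  have : 0 < (1 - eta) * c by rewrite mulr_gt0 ?subr_gt0.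
  by lra.
have rho_lt1 : rho < 1.
  rewrite gt_max ltr_pdivrMr // mul1r; apply/andP; split; first by rewrite /c; lra.
  have : 0 < (1 - eta) * (1 - c) by rewrite mulr_gt0 ?subr_gt0.
  lra.
exists rho; first by rewrite rho_gt0.
move=> t m [|b w] /=; first by rewrite written_prob_prefix_nil.
have [||||||| le _] := @written_prob_prefix_le c rho rho0 eta _ _ _ _ _ _ _ m t b w.
- by rewrite !ltW.
- by rewrite !ltW.
- by [].
- by rewrite mulrC -ler_pdivrMr // le_max lexx.
- by rewrite le_max lexx orbT.
- by move=> a b'; rewrite -ler_pdivrMr //; exact: (rho0_le (a, b')).
- move=> q b'; apply: le_trans (eta_le q); rewrite (bigD1 b') //= lerDl.
  by apply: sumr_ge0 => a _; exact: muW_ge0.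
by apply: le_trans le _; rewrite ler_piMl ?exprn_ge0 // ltW.
Qed.

(** When (1) fails for [a] and [b], everything written in response to [a] is almost surely [b], so
    [nseq K b] is missed only if fewer than [K] symbols appear in [m] steps. Each missing symbol
    costs a factor 4, and each step earns the factor [(1 + muR s a (inl s)) / 2]. A step reads at
    most one symbol, so [m] steps see only [a]. *)
Lemma written_prob_nseq_ge a b :
  1 <= muR s a (inl s) + first_letter_prob a b ->
  forall m K t, (forall i, (i < m)%N -> t i = a) ->
  1 - 4 ^+ K * ((1 + muR s a (inl s)) / 2) ^+ m <=
  written_prob t (inl s) m (prefix (nseq K b)).
Proof.
move=> H.
set dl := muR s a (inl s); set th := (1 + dl) / 2.
have dl_ge0 : 0 <= dl by exact: muR_ge0.
have dl_le1 : dl <= 1 by case/andP: (muR_itv s a (inl s)).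
have th_ge : 2^-1 <= th by rewrite /th; lra.
have th_ge0 : 0 <= th by lra.
have split_R : dl + \sum_q muR s a (inr q) = 1 by exact: muR_split.
have certain q : muR s a (inr q) != 0 -> muW q b (inl s) + muW q b (inr q) = 1.
  move=> nz.
  (* [F] is the chance to enter [q] and not write [b] first; these nonnegative terms sum to at most
     0 by [H], so each is 0. *)
  pose F q := muR s a (inr q) * (1 - (muW q b (inr q) + muW q b (inl s))).
  have F_ge0 q' : true -> 0 <= F q'.
    by move=> _; rewrite mulr_ge0 ?muR_ge0 // subr_ge0 addrC muW_le1.
  have F0 : \sum_q F q = 0.
    apply/eqP; rewrite eq_le sumr_ge0 // andbT.
    rewrite (eq_bigr _ (fun q _ => mulrBr _ _ _)) sumrB.
    rewrite (eq_bigr _ (fun q _ => mulr1 _)) -/(first_letter_prob a b).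
    by move: H; rewrite -/dl; lra.
  have /eqP := psumr_eq0P F_ge0 F0 (erefl true : (fun=> true) q).
  by rewrite mulf_eq0 (negPf nz) /= subr_eq0 => /eqP ->; rewrite addrC.
move=> m K t ta.
(* The factor [2^-1] for output states pays for the steps at which [s] deletes
   the input symbol. *)
suff [] : 1 - 4 ^+ K * th ^+ m <= written_prob t (inl s) m (prefix (nseq K b)) /\
  forall q, muR s a (inr q) != 0 ->
  1 - 2^-1 * (4 ^+ K * th ^+ m) <= written_prob t (inr q) m (prefix (nseq K b)).
  by [].
have bnd_ge0 k n : 0 <= 4 ^+ k * th ^+ n by rewrite mulr_ge0 ?exprn_ge0.
elim: m K t ta => [|m IH] [|K] t ta.
1,3: by split=> [|q _]; rewrite /nseq /= written_prob_prefix_nil gerBl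
     ?mulr_ge0 ?exprn_ge0 ?invr_ge0.
  (* Without steps the probability is 0, and both bounds are negative or zero because
     [4 ^+ K.+1 / 2 >= 1]. *)
  have : 1 <= 4 ^+ K :> R by rewrite exprn_ege1 // ler1n.
  by split=> [|q _]; rewrite written_prob0 /= exprS; lra.
split=> [|q nz]; last have sure := certain q nz.
  rewrite written_prob_star_istate ta //; set t' := fun i => t i.+1.
  have [|les leq] := IH K.+1 t' => [i im|]; first by rewrite /t' ta.
  rewrite -/dl.
  have /(lerD (ler_wpM2l dl_ge0 les)) :
    (1 - dl) * (1 - 2^-1 * (4 ^+ K.+1 * th ^+ m)) <=
    \sum_q muR s a (inr q) * written_prob t' (inr q) m (prefix (nseq K.+1 b)).
    have -> : 1 - dl = \sum_q muR s a (inr q) by lra.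
    rewrite mulr_suml; apply: ler_sum => q _.
    have [->|nz] := eqVneq (muR s a (inr q)) 0; first by rewrite !mul0r.
    by rewrite ler_wpM2l ?muR_ge0 // leq.
  (* The probability of a miss is at most [dl * z + (1 - dl) * z / 2], which is [th * z]; this
     dictates the value of [th]. *)
  apply: le_trans; rewrite [th ^+ m.+1]exprS; have := bnd_ge0 K.+1 m.
  set z := _ * th ^+ m; rewrite [4 ^+ _ * (th * _)]mulrCA -/z /th; lra.
rewrite [nseq _ _]/= written_prob_star_ostate.
have ta' i : (i < m)%N -> t i = a by move=> im; rewrite ta // ltnW.
have [les /(_ q) leq] := IH K t ta'.
have {}leq : 1 - 4 ^+ K * th ^+ m <= written_prob t (inr q) m (prefix (nseq K b)).
  by apply: le_trans (leq nz); have := bnd_ge0 K m; lra.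
have := lerD (ler_wpM2l (muW_ge0 q b (inl s)) les)
             (ler_wpM2l (muW_ge0 q b (inr q)) leq).
rewrite -mulrDl sure mul1r; apply: le_trans.
(* The written [b] frees a factor 4, which covers the extra [th] and [2^-1] because
   [4 * th / 2 >= 1]. *)
rewrite !exprS; have := ler_wpM2r (bnd_ge0 K m) th_ge.
set z := 4 ^+ K * _.
have -> : 4 * 4 ^+ K * (th * th ^+ m) = 4 * (th * z) by rewrite /z; ring.
lra.
Qed.

End StarLike.

Lemma onth_take (T : Type) k i (w : seq T) : (i < k)%N ->
  onth (take k w) i = onth w i.
Proof. by move=> ik; rewrite !onthE map_take nth_take. Qed.

(** * Outputs as limits of finite written words *)

Section Output.
Context (Sigma : finType).
Implicit Types (o : nat -> option Sigma).

Lemma written_cat o k n : exists w, written o (k + n) = written o k ++ w.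
Proof. by rewrite /written iotaD pmap_cat; eexists. Qed.

Lemma onth_written_le o k k' i a : (k <= k')%N ->
  onth (written o k) i = Some a -> onth (written o k') i = Some a.
Proof.
move=> /subnKC <-; have [w ->] := written_cat o k (k' - k).
rewrite onth_cat => ka; have := onthNE (written o k) i; rewrite ka /=.
by case: leqP.
Qed.

Lemma output_letterP o i a :
  output o i = Some a <-> exists k, onth (written o k) i = Some a.
Proof.
rewrite /= /output_letter; case: xgetP => [_ -> [b [k kb] <-]|none]; split.
- by case=> <-; exists k.
- move=> [k' ka]; congr Some.
  have := onth_written_le (leq_maxl k k') kb.
  by rewrite (onth_written_le (leq_maxr k k') ka) => -[].
- by [].
- by move=> [k ka]; case: (none (Some a)); exists a => //; exists k.
Qed.

(** The length conditions prevent words shorter than [k] from agreeing by truncation. *)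
Definition agree k (w v : seq Sigma) :=
  [&& k <= size w, k <= size v & take k w == take k v]%N.

Lemma agree_written_le o o' k m n : (m <= n)%N ->
  agree k (written o m) (written o' m) -> agree k (written o n) (written o' n).
Proof.
move=> /subnKC <-.
have [w ->] := written_cat o m (n - m); have [v ->] := written_cat o' m (n - m).
move=> /and3P[kw kv eq_wv]; rewrite /agree !size_cat !takel_cat // eq_wv.
by rewrite (leq_trans kw (leq_addr _ _)) (leq_trans kv (leq_addr _ _)).
Qed.

(** The two outputs may reach length [k] at different times; written words only grow, so the later
    time serves both. Agreement thus becomes a countable union of events about finitely many
    steps. *)
Lemma output_agreeP o o' k :
  (forall i, (i < k)%N -> output o i <> None /\ output o i = output o' i) <->
  exists m, agree k (written o m) (written o' m).
Proof.
split=> [out|[m /and3P[km km' /eqP eq_take]] i ik]; last first.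
  have onth_i : onth (written o m) i = onth (written o' m) i.
    by rewrite -(onth_take _ ik) eq_take onth_take.
  case E : (onth (written o m) i) => [a|]; last first.
    by have := onthNE (written o m) i; rewrite E leqNgt (leq_trans ik km).
  have -> : output o i = Some a by apply/output_letterP; exists m.
  by split=> //; apply/esym/output_letterP; exists m; rewrite -onth_i.
have long o1 : (forall i, (i < k)%N -> output o1 i <> None) ->
    exists m, (k <= size (written o1 m))%N.
  case: (k) => [|j] out1; first by exists 0%N.
  have := out1 j (ltnSn j); case E : (output o1 j) => [a|] // _.
  have /output_letterP[m ma] := E; exists m.
  by have := onthNE (written o1 m) j; rewrite ma ltnNge => <-.
have [m km] := long o (fun i ik => (out i ik).1).
have [m' km'] : exists m, (k <= size (written o' m))%N.
  by apply: long => i /out[] + <-.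
pose M := maxn m m'.
have kM : (k <= size (written o M))%N.
  have [w ->] : exists w, written o M = written o m ++ w.
    by rewrite /M -(subnKC (leq_maxl m m')); exact: written_cat.
  by rewrite size_cat (leq_trans km (leq_addr _ _)).
have kM' : (k <= size (written o' M))%N.
  have [w ->] : exists w, written o' M = written o' m' ++ w.
    by rewrite /M -(subnKC (leq_maxr m m')); exact: written_cat.
  by rewrite size_cat (leq_trans km' (leq_addr _ _)).
exists M; rewrite /agree kM kM'; apply/eqP/eq_from_onth_le => i.
rewrite !size_takel // maxnn => ik; rewrite !onth_take //.
have [_ eq_out] := out i ik.
have [a oa] : exists a, onth (written o M) i = Some a.
  case E : (onth _ i) => [a|]; first by exists a.
  by have := onthNE (written o M) i; rewrite E leqNgt (leq_trans ik kM).
have [a' oa'] : exists a, onth (written o' M) i = Some a.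
  case E : (onth _ i) => [b|]; first by exists b.
  by have := onthNE (written o' M) i; rewrite E leqNgt (leq_trans ik kM').
have /output_letterP outa : exists m, onth (written o m) i = Some a by exists M.
have /output_letterP outa' : exists m, onth (written o' m) i = Some a' by exists M.
by rewrite oa oa' -outa -outa'.
Qed.

Lemma agree_prefix k w v : agree k w v -> prefix (take k w) v.
Proof. by move=> /and3P[_ _ /eqP ->]; exact: prefix_take. Qed.

Lemma prefix_agree u w v : prefix u w -> prefix u v -> agree (size u) w v.
Proof.
move=> /prefixP[w' ->] /prefixP[v' ->].
by rewrite /agree !size_cat !leq_addr !take_size_cat ?eqxx.
Qed.
End Output.

Lemma measure_finite_union (R : realType) d (T : measurableType d)
    (mu : {measure set T -> \bar R}) (I : finType) (B : pred I) (F : I -> set T) :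
  (forall i, measurable (F i)) -> trivIset setT F ->
  mu (\bigcup_(i in [set i | B i]) F i) = (\sum_(i | B i) mu (F i))%E.
Proof.
move=> mF tF; rewrite measure_fin_bigcup //; last 2 first.
- exact: finite_finset.
- exact: sub_trivIset tF.
by rewrite [RHS]bigfs ?index_enum_uniq // => i _; rewrite mem_index_enum.
Qed.

Lemma measurable_bigmaxe (R : realType) d (T : measurableType d) (I : Type)
    (r : seq I) (B : pred I) (f : I -> T -> \bar R) :
  (forall i, measurable_fun setT (f i)) ->
  measurable_fun setT (fun x => \big[maxe/0%E]_(i <- r | B i) f i x).
Proof.
move=> mf; elim: r => [|i r IH].
  by under eq_fun do rewrite big_nil; exact: measurable_cst.
under eq_fun do rewrite big_cons.
by case: (B i) => //; exact: measurable_maxe.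
Qed.

(** * Joint law of the runs on two strings *)

Section Runs.
Context (R : realType) (Sigma : finType) (X : pfa R Sigma) (s : istate X).
Context (X_star : star_like s) (X_canonical : canonical_form s).
Context d (T : measurableType d) (P : probability T R).
Context (Y : iword Sigma -> T -> run X) (Y_runs : random_runs P Y).
Implicit Types (u v t : iword Sigma).

Definition steps t m (om : T) : seq (option Sigma * state X) := mkseq (Y t om).2 m.

Lemma init_ostate (q : ostate X) : init X (inr q) = 0.
Proof.
have := init_sum X; rewrite (sum_state X_star) X_canonical.
move=> /(canRL (addKr _)); rewrite addNr => /psumr_eq0P -> // q' _.
by case/andP: (init_itv (inr q' : state X)).
Qed.

Let history m := (state X * m.-tuple (option Sigma * state X))%type.

Definition joint_cylinder u v m
    (i : history m * history m) : set T :=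
  Y u @^-1` cylinder i.1.1 i.1.2 `&` Y v @^-1` cylinder i.2.1 i.2.2.

Lemma measurable_joint_cylinder u v m i : measurable (@joint_cylinder u v m i).
Proof. by have [mY _ _] := Y_runs; exact: measurableI. Qed.

Lemma trivIset_joint_cylinder u v m : trivIset setT (@joint_cylinder u v m).
Proof.
move=> [[q r] [q' r']] [[p z] [p' z']] _ _
  [om [[[/= <- Er] [/= <- Er']] [[/= -> Ez] [/= -> Ez']]]].
have -> : r = z by apply: val_inj; rewrite /= -Er -Ez !size_tuple.
by have -> : r' = z' by apply: val_inj; rewrite /= -Er' -Ez' !size_tuple.
Qed.

(** A finite disjoint union of cylinders, on which the law and the independence are given. *)
Lemma joint_event u v m (B : rel (seq (option Sigma * state X))) :
  [set om | B (steps u m om) (steps v m om)] =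
  \bigcup_(i in [set i : history m * history m | B i.1.2 i.2.2])
    @joint_cylinder u v m i.
Proof.
apply/seteqP; split=> [om Bom|om [[[q r] [q' r']] /= Bi [[/= _ Er] [/= _ Er']]]].
  pose tup t := @Tuple m _ (steps t m om) (introT eqP (size_mkseq _ _)).
  exists (((Y u om).1, tup u), ((Y v om).1, tup v)) => //=.
  by split; split=> //=; rewrite size_mkseq.
by move: Bi; rewrite -Er -Er' !size_tuple.
Qed.

Lemma measurable_joint_event u v m (B : rel (seq (option Sigma * state X))) :
  measurable [set om | B (steps u m om) (steps v m om)].
Proof.
rewrite joint_event; apply: fin_bigcup_measurable => [|i _]; first exact: finite_finset.
exact: measurable_joint_cylinder.
Qed.

Lemma prob_joint_cylinder u v m i : u != v ->
  P (@joint_cylinder u v m i) =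
  (init X i.1.1 * steps_prob u i.1.1 i.1.2 *
   (init X i.2.1 * steps_prob v i.2.1 i.2.2))%:E.
Proof.
move=> neq_uv; have [_ lawY indepY] := Y_runs.
have := indepY [fset u; v]%fset (fun t => if t == u then i.1.1 else i.2.1)
  (fun t => if t == u then i.1.2 : seq _ else i.2.2).
rewrite big_fsetU1 /= ?inE // big_seq_fset1 eqxx eq_sym (negPf neq_uv).
rewrite !lawY -EFinM => <-; congr (P _).
apply/seteqP; split=> [om [Yu Yv] t /=|om Yom].
  by rewrite !inE => /orP[] /eqP ->; rewrite ?eqxx // eq_sym (negPf neq_uv).
split; first by have := Yom u; rewrite /= !inE !eqxx; apply.
by have := Yom v; rewrite /= !inE eqxx orbT eq_sym (negPf neq_uv); apply.
Qed.

Lemma sum_init (F : state X -> R) : \sum_q init X q * F q = F (inl s).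
Proof.
rewrite (sum_state X_star) X_canonical mul1r big1 ?addr0 // => q _.
by rewrite init_ostate mul0r.
Qed.

(** The run on [u] is summed outside, so that the inner sum is the conditional probability given
    that run. *)
Lemma prob_joint_event u v m (B : rel (seq (option Sigma * state X))) : u != v ->
  P [set om | B (steps u m om) (steps v m om)] =
  (\sum_(r : m.-tuple _) steps_prob u (inl s) r *
     \sum_(r' : m.-tuple _ | B r r') steps_prob v (inl s) r')%:E.
Proof.
move=> neq_uv; rewrite joint_event measure_finite_union; last 2 first.
- exact: measurable_joint_cylinder.
- exact: trivIset_joint_cylinder.
rewrite (eq_bigr _ (fun i _ => prob_joint_cylinder i neq_uv)) sumEFin; congr EFin.
rewrite big_mkcond /=.
rewrite -(pair_bigA _ (fun x y : history m => if B x.2 y.2 then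
  init X x.1 * steps_prob u x.1 x.2 * (init X y.1 * steps_prob v y.1 y.2) else 0)) /=.
rewrite -(pair_bigA _ (fun q (r : m.-tuple _) =>
  \sum_(y : history m) if B r y.2 then
  init X q * steps_prob u q r * (init X y.1 * steps_prob v y.1 y.2) else 0)) /=.
rewrite -(sum_init (fun q => \sum_(r : m.-tuple _) steps_prob u q r *
  \sum_(r' : m.-tuple _ | B r r') steps_prob v (inl s) r')).
apply: eq_bigr => q _; rewrite mulr_sumr; apply: eq_bigr => r _.
rewrite -(pair_bigA _ (fun q' (r' : m.-tuple _) => if B r r' then
  init X q * steps_prob u q r * (init X q' * steps_prob v q' r') else 0)) /=.
rewrite -(sum_init (fun q' => \sum_(r' : m.-tuple _ | B r r') steps_prob v q' r')).
rewrite mulrA mulr_sumr; apply: eq_bigr => q' _.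
by rewrite -big_mkcond /= !mulr_sumr.
Qed.

(** * Probability that two outputs agree *)

Definition agree_event u v k : set T :=
  [set om | forall i, (i < k)%N -> run_output (Y u om) i <> None /\
                      run_output (Y u om) i = run_output (Y v om) i].

Definition agree_by u v k m : set T :=
  [set om | agree k (pmap fst (steps u m om)) (pmap fst (steps v m om))].

Lemma written_steps t m om :
  written (fun i => ((Y t om).2 i).1) m = pmap fst (steps t m om).
Proof.
rewrite /written /steps /mkseq; elim: (iota 0 m) => //= i r <-.
by case: ((Y t om).2 i).1.
Qed.

Lemma agree_event_bigcup u v k : agree_event u v k = \bigcup_m agree_by u v k m.
Proof.
apply/seteqP; split=> om.
  by move/output_agreeP => [m]; rewrite !written_steps => ?; exists m.
by move=> [m _ ?]; apply/output_agreeP; exists m; rewrite !written_steps.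
Qed.

Lemma measurable_agree_by u v k m : measurable (agree_by u v k m).
Proof.
exact: (@measurable_joint_event u v m
          (fun r r' => agree k (pmap fst r) (pmap fst r'))).
Qed.

Lemma measurable_agree_event u v k : measurable (agree_event u v k).
Proof.
rewrite agree_event_bigcup; apply: bigcup_measurable => m _.
exact: measurable_agree_by.
Qed.

Lemma prob_agree_event_le (rho : R) u v k :
  0 <= rho ->
  (forall t m w, written_prob t (inl s) m (prefix w) <= rho ^+ (size w).-1) ->
  u != v -> (P (agree_event u v k) <= (rho ^+ k.-1)%:E)%E.
Proof.
move=> rho_ge0 decay neq_uv.
have mE := measurable_agree_event u v k; rewrite agree_event_bigcup in mE *.
have homo : {homo agree_by u v k : m n / (m <= n)%N >-> (m <= n)%O}.
  move=> m n mn; apply/subsetPset => om.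
  by rewrite /agree_by /= -!written_steps; exact: agree_written_le.
(* Continuity from below reduces the claim to a bound uniform in the time [m]. *)
have cvgP := nondecreasing_cvg_mu (mu := P) (measurable_agree_by u v k) mE homo.
rewrite -(cvg_lim _ cvgP) //; apply: lime_le.
  by apply/cvg_ex; eexists; exact: cvgP.
apply: nearW => m /=.
rewrite (prob_joint_event _ (fun r r' => agree k (pmap fst r) (pmap fst r'))) //.
rewrite lee_fin -[leRHS]mul1r -(written_probT u (inl s : state X) m) mulr_suml.
apply: ler_sum => r _; apply: ler_wpM2l; first exact: steps_prob_ge0.
have [kr|rk] := leqP k (size (pmap fst r)); last first.
  rewrite big_pred0 => [|r']; last by rewrite /agree leqNgt rk.
  exact: exprn_ge0.
(* Once the steps [r] on [u] are fixed, agreement forces the output on [v] to begin with a fixed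
   word of length [k]. *)
apply: le_trans (_ : written_prob v (inl s) m (prefix (take k (pmap fst r))) <= _).
  rewrite /written_prob big_mkcond [leRHS]big_mkcond; apply: ler_sum => r' _.
  by case: ifP => [/agree_prefix -> //|_]; case: ifP; rewrite ?steps_prob_ge0.
by apply: le_trans (decay _ _ _) _; rewrite size_takel.
Qed.

(** By independence the left side is the probability that both runs begin with [w] within [m]
    steps. *)
Lemma prob_agree_event_ge u v w m : u != v ->
  ((written_prob u (inl s) m (prefix w) *
    written_prob v (inl s) m (prefix w))%:E <= P (agree_event u v (size w)))%E.
Proof.
move=> neq_uv.
pose B (r r' : seq (option Sigma * state X)) :=
  prefix w (pmap fst r) && prefix w (pmap fst r').
have -> : written_prob u (inl s) m (prefix w) * written_prob v (inl s) m (prefix w) =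
    \sum_(r : m.-tuple _) steps_prob u (inl s) r *
    \sum_(r' : m.-tuple _ | B r r') steps_prob v (inl s) r'.
  rewrite /written_prob mulr_suml big_mkcond; apply: eq_bigr => r _; rewrite /B.
  by case: (prefix w _) => //=; rewrite big_pred0_eq mulr0.
rewrite -(prob_joint_event _ B) // le_measure ?inE //.
- exact: measurable_joint_event.
- exact: measurable_agree_event.
- move=> om /andP[wu wv]; rewrite agree_event_bigcup; exists m => //.
  exact: prefix_agree.
Qed.

(** * Longest common prefixes and their expectation *)

Definition pair_lcp u v om : \bar R :=
  lcp R (run_output (Y u om)) (run_output (Y v om)).

Lemma agree_event_lcp u v k om :
  agree_event u v k om -> (k%:R%:E <= pair_lcp u v om)%E.
Proof. by move=> Gk; apply: ereal_sup_ubound; exists k. Qed.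

Lemma lt_lcpP u v (y : \bar R) om : (y < pair_lcp u v om)%E ->
  exists2 k, agree_event u v k om & (y < k%:R%:E)%E.
Proof. by move=> /ereal_sup_gt[_ [k Gk <-] yk]; exists k. Qed.

Lemma measurable_pair_lcp u v : measurable_fun setT (pair_lcp u v).
Proof.
apply: (measurability _ (ErealGenOInfty.measurableE R)) => _ [_ [y ->] <-].
rewrite setTI [X in measurable X](_ : _ =
  \bigcup_(k in [set k | (y < k%:R)%R]) agree_event u v k).
  by apply: bigcup_measurable => k _; exact: measurable_agree_event.
apply/seteqP; split=> om /=.
  rewrite in_itv /= andbT => /lt_lcpP[k Gk yk]; by exists k.
move=> [k /= yk Gk]; rewrite in_itv /= andbT.
by apply: lt_le_trans (agree_event_lcp Gk); rewrite lte_fin.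
Qed.

Definition max_lcp (A : {fset iword Sigma}) om : \bar R :=
  \big[maxe/0%E]_(u <- A) \big[maxe/0%E]_(v <- A | v != u) pair_lcp u v om.

Lemma measurable_max_lcp A : measurable_fun setT (max_lcp A).
Proof.
apply: measurable_bigmaxe => u; apply: measurable_bigmaxe => v.
exact: measurable_pair_lcp.
Qed.

Lemma max_lcp_ge0 A om : (0 <= max_lcp A om)%E.
Proof. by apply: bigmax_ge_id. Qed.

Lemma le_max_lcp (A : {fset iword Sigma}) u v om : u \in A -> v \in A -> v != u ->
  (pair_lcp u v om <= max_lcp A om)%E.
Proof.
move=> uA vA neq_vu; apply: (@bigmax_sup_seq _ _ _ _ _ u) => //.
exact: (@le_bigmax_seq _ _ _ _ _ v).
Qed.

Lemma smoothed_heightE n : smoothed_height P Y setT n =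
  ereal_sup [set (\int[P]_om max_lcp A om)%E |
    A in [set A : {fset iword Sigma} | #|` A|%fset = n]].
Proof.
rewrite /smoothed_height; congr ereal_sup; apply/seteqP.
by split=> [_ [A [_ cardA] <-]|_ [A cardA <-]]; exists A.
Qed.

(** Markov's inequality. *)
Lemma integral_max_lcp_ge (A : {fset iword Sigma}) u v k (p : R) :
  u \in A -> v \in A -> u != v -> (p%:E <= P (agree_event u v k))%E ->
  ((k%:R * p)%:E <= \int[P]_om max_lcp A om)%E.
Proof.
move=> uA vA neq_uv le_p.
have mG := measurable_agree_event u v k.
apply: (@le_trans _ _ (\int[P]_om (k%:R%:E * (\1_(agree_event u v k) om)%:E))%E).
  rewrite ge0_integralZl_EFin //; last first.
    exact/measurable_EFinP/measurable_indic.
  rewrite integral_indic // setIT EFinM.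
  by apply: lee_wpmul2l => //; rewrite lee_fin.
apply: ge0_le_integral => //.
- apply/measurable_EFinP; apply: measurable_funM => //; exact: measurable_indic.
- exact: measurable_max_lcp.
- move=> om _; rewrite indicE; case: (boolP (om \in _)) => [|_].
    rewrite inE => Gom; rewrite mule1; apply: le_trans (agree_event_lcp Gom) _.
    by apply: le_max_lcp; rewrite // eq_sym.
  by rewrite mule0 max_lcp_ge0.
Qed.

(** The positive part of [pair_lcp u v om - K], written as a sum of indicators so that its
    expectation is a series of agreement probabilities. *)
Definition excess u v K om : \bar R :=
  (\sum_(0 <= j <oo) (\1_(agree_event u v (K + j).+1) om)%:E)%E.

Lemma excess_ge0 u v K om : (0 <= excess u v K om)%E.
Proof. by apply: nneseries_ge0 => j _ _; rewrite lee_fin. Qed.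

Lemma measurable_excess u v K : measurable_fun setT (excess u v K).
Proof.
apply: ge0_emeasurable_sum => j *; first by rewrite lee_fin.
apply/measurable_EFinP/measurable_indic; exact: measurable_agree_event.
Qed.

Lemma pair_lcp_le u v K om : (pair_lcp u v om <= K%:R%:E + excess u v K om)%E.
Proof.
apply: ge_ereal_sup => _ [k Gk <-].
have [kK|/ltnW /subnKC <-] := leqP k K.
  apply: (@le_trans _ _ K%:R%:E); first by rewrite lee_fin ler_nat.
  by rewrite leeDl // excess_ge0.
rewrite natrD EFinD leeD2l //.
(* Agreement on [k] symbols entails agreement on fewer, so the first [k - K] terms equal 1. *)
apply: le_trans (nneseries_lim_ge (k - K) _) => [|j _ _]; last by rewrite lee_fin.
rewrite big_mkord (eq_bigr (fun=> 1%:E)) => [|j _].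
  by rewrite sumEFin sumr_const card_ord.
rewrite indicE mem_set // => i le_i; apply: Gk; apply: leq_trans le_i _.
by rewrite -ltn_subRL.
Qed.

Lemma integral_excess_le (rho : R) u v K : 0 < rho < 1 ->
  (forall t m w, written_prob t (inl s) m (prefix w) <= rho ^+ (size w).-1) ->
  u != v -> (\int[P]_om excess u v K om <= (rho ^+ K / (1 - rho))%:E)%E.
Proof.
move=> /andP[rho_gt0 rho_lt1] decay neq_uv.
rewrite integral_nneseries //; last first.
  move=> j; apply/measurable_EFinP/measurable_indic; exact: measurable_agree_event.
apply: lime_le.
  by apply: is_cvg_nneseries => j _ _; apply: integral_ge0 => om _; rewrite lee_fin.
apply: nearW => N.
(* The successor in the index of [excess] cancels the predecessor in the exponent of the agreement
   bound. *)
apply: (@le_trans _ _ (\sum_(0 <= j < N) (rho ^+ (K + j))%:E)%E).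
  apply: lee_sum => j _; rewrite integral_indic ?setIT //; last first.
    exact: measurable_agree_event.
  by apply: prob_agree_event_le => //; exact: ltW.
rewrite sumEFin lee_fin; apply: le_trans (geometric_le_lim N _ rho_gt0 _).
- rewrite /series /geometric /=; apply: ler_sum => j _; by rewrite exprD.
- by rewrite exprn_ge0 // ltW.
- by rewrite gtr0_norm.
Qed.

(** The union bound in expectation: the maximum is at most [K] plus the excesses of all pairs. *)
Lemma integral_max_lcp_le (rho : R) (A : {fset iword Sigma}) K : 0 < rho < 1 ->
  (forall t m w, written_prob t (inl s) m (prefix w) <= rho ^+ (size w).-1) ->
  (\int[P]_om max_lcp A om <=
   (K%:R + rho ^+ K / (1 - rho) *+ #|` A|%fset *+ #|` A|%fset)%:E)%E.
Proof.
move=> rho01 decay.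
(* The diagonal is set to 0: the sums run over all pairs, but the tail bound needs distinct
   strings. *)
pose e u v om : \bar R := if v != u then excess u v K om else 0%E.
have e_ge0 u v om : (0 <= e u v om)%E.
  by rewrite /e; case: ifP => // _; exact: excess_ge0.
have me u v : measurable_fun setT (e u v).
  by rewrite /e; case: (v != u); [exact: measurable_excess | exact: measurable_cst].
have se_ge0 u om : (0 <= \sum_(v <- A) e u v om)%E by exact: sume_ge0.
have mse u : measurable_fun setT (fun om => \sum_(v <- A) e u v om)%E.
  exact: emeasurable_sum.
have sse_ge0 om : (0 <= \sum_(u <- A) \sum_(v <- A) e u v om)%E by exact: sume_ge0.
have msse : measurable_fun setT (fun om => \sum_(u <- A) \sum_(v <- A) e u v om)%E.
  exact: emeasurable_sum.
apply: (@le_trans _ _ (\int[P]_om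
    (K%:R%:E + \sum_(u <- A) \sum_(v <- A) e u v om))%E).
  apply: ge0_le_integral => //.
  - by move=> om _; exact: max_lcp_ge0.
  - exact: measurable_max_lcp.
  - by apply: emeasurable_funD => //; exact: measurable_cst.
  move=> om _; rewrite /max_lcp big_seq.
  have K_ge0 : (0 <= K%:R%:E + \sum_(u <- A) \sum_(v <- A) e u v om)%E.
    by rewrite adde_ge0 // lee_fin.
  apply: bigmax_le => // u uA; rewrite big_seq_cond.
  apply: bigmax_le => // v /andP[vA neq_vu].
  apply: le_trans (pair_lcp_le u v K om) _; rewrite leeD2l //.
  rewrite (bigD1_seq u) ?fset_uniq //= (bigD1_seq v) ?fset_uniq //= {1}/e neq_vu.
  by rewrite -addeA leeDl // adde_ge0 // sume_ge0.
rewrite ge0_integralD //.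
rewrite integral_cst //= probability_setT mule1 EFinD leeD2l //.
rewrite ge0_integral_sum //.
have le_e u v : (\int[P]_om e u v om <= (rho ^+ K / (1 - rho))%:E)%E.
  rewrite /e; have [_|neq_vu] := eqVneq v u; last first.
    by apply: integral_excess_le; rewrite // eq_sym.
  have /andP[r0 r1] := rho01.
  by rewrite integral0 lee_fin divr_ge0 ?exprn_ge0 ?subr_ge0 // ltW.
apply: (@le_trans _ _ (\sum_(u <- A) \sum_(v <- A) (rho ^+ K / (1 - rho))%:E)%E).
  by apply: lee_sum => u _; rewrite ge0_integral_sum //; apply: lee_sum.
under eq_bigr do rewrite sumEFin.
rewrite sumEFin lee_fin !big_const_seq !count_predT !iter_addr_0.
by [].
Qed.
End Runs.

(** For [K] just above [2 * ln n / - ln rho] the product [rho ^+ K * n * n] is at most 1, so the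
    tail term stays bounded. *)
Lemma log_bound (R : realType) (rho : R) : 0 < rho < 1 ->
  exists C : R, forall n, (1 < n)%N ->
    exists K, K%:R + rho ^+ K / (1 - rho) *+ n *+ n <= C * ln n%:R.
Proof.
move=> /andP[r0 r1].
have L_gt0 : 0 < - ln rho by rewrite oppr_gt0 ln_lt0 ?r0.
have ln2_gt0 : 0 < ln 2 :> R by rewrite ln_gt0 // ltr1n.
set L := - ln rho in L_gt0.
(* The first term pays for [K] up to rounding; the second absorbs the rounding and the tail, as
   [ln 2 <= ln n]. *)
exists (2 / L + (1 + (1 - rho)^-1) / ln 2) => n n1.
have n_gt0 : 0 < n%:R :> R by rewrite ltr0n ltnW.
have ln_n : ln 2 <= ln n%:R :> R by rewrite ler_ln ?posrE ?ler_nat // ltr0n.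
pose x := 2 / L * ln n%:R.
have x_ge0 : 0 <= x by rewrite mulr_ge0 ?divr_ge0 // ltW // (lt_le_trans ln2_gt0).
have [K K_ge K_le] : exists2 K : nat, x < K%:R & K%:R <= x + 1.
  exists (Num.trunc x).+1; first exact: truncnS_gt.
  by rewrite -natr1 lerD2r; case/andP: (truncn_itv x_ge0).
exists K.
have small : rho ^+ K * n%:R * n%:R <= 1.
  have -> : rho ^+ K = expR (- (K%:R * L)).
    by rewrite -mulrN opprK expRM_natl lnK ?posrE.
  rewrite -{1 2}(lnK (_ : n%:R \is Num.pos)) ?posrE // -!expRD expR_le1.
  have := ler_wpM2r (ltW L_gt0) (ltW K_ge).
  have -> : x * L = 2 * ln n%:R by rewrite /x mulrAC divfK // gt_eqF.
  by lra.
have tail_le : rho ^+ K / (1 - rho) *+ n *+ n <= (1 - rho)^-1.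
  rewrite -[leLHS]mulr_natr -[in leLHS]mulr_natr.
  have -> : rho ^+ K / (1 - rho) * n%:R * n%:R =
      (rho ^+ K * n%:R * n%:R) * (1 - rho)^-1.
    by rewrite (mulrAC (rho ^+ K)) (mulrAC (rho ^+ K * n%:R)).
  by rewrite ler_piMl // invr_ge0 subr_ge0 ltW.
have : 1 + (1 - rho)^-1 <= (1 + (1 - rho)^-1) / ln 2 * ln n%:R.
  rewrite -mulrA ler_peMr ?addr_ge0 // ?invr_ge0 ?subr_ge0 ?(ltW r1) //.
  by rewrite mulrC ler_pdivlMr // mul1r.
by move=> ?; rewrite mulrDl -/x (le_trans (lerD K_le tail_le)) // -addrA lerD2l.
Qed.

(** * Arbitrarily many strings with a long common prefix *)

Section Strings.
Context (Sigma : finType) (a c : Sigma).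
Context (neq_ac : a != c).

(** The position of the single [c] distinguishes the strings, and it lies beyond the common prefix
    of [M] symbols [a]. *)
Definition marked_string (M i : nat) : iword Sigma :=
  fun j => if j == (M + i)%N then c else a.

Lemma marked_string_prefix M i j : (j < M)%N -> marked_string M i j = a.
Proof.
move=> jM; rewrite /marked_string; case: eqP => // jE.
by rewrite jE ltnNge leq_addr in jM.
Qed.

Lemma marked_string_inj M : injective (marked_string M).
Proof.
move=> i j /(congr1 (fun t => t (M + i)%N)).
rewrite /marked_string eqxx eqn_add2l; case: eqP => // _ ca.
by move: neq_ac; rewrite ca eqxx.
Qed.

Definition marked_strings M n : {fset iword Sigma} :=
  [fset marked_string M (val i) | i in 'I_n]%fset.

Lemma card_marked_strings M n : #|` marked_strings M n|%fset = n.
Proof.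
rewrite /marked_strings card_imfset /=; last first.
  by move=> i j /marked_string_inj /val_inj.
by rewrite -cardE card_ord.
Qed.

Lemma mem_marked_strings M n i : (i < n)%N ->
  marked_string M i \in marked_strings M n.
Proof. by move=> lt_in; apply/imfsetP; exists (Ordinal lt_in). Qed.
End Strings.

(** * Condition (1) and logarithmic height *)

Theorem theorem1 (R : realType) (Sigma : finType) (X : pfa R Sigma)
    (s : istate X)
    (X_star : star_like s)
    (X_canonical : canonical_form s)
    (X_del : forall a : Sigma, muR s a (inl s) < 1)
    (d : measure_display) (T : measurableType d) (P : probability T R)
    (Y : iword Sigma -> T -> run X)
    (Y_runs : random_runs P Y) :
  (forall a b : Sigma,
     muR s a (inl s) +
     \sum_(q : ostate X) muR s a (inr q) * (muW q b (inr q) + muW q b (inl s))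
     < 1)
  <-> is_O_log (smoothed_height P Y setT).
Proof.
split=> [H|[C [N _ HC]] a b].
- have [rho rho01 decay] := written_prob_exp_decay X_star H.
  have [q0 _] : exists q0 : ostate X, true.
    by have /card_gt0P[q0 _] := ostate_neq0 X; exists q0.
  (* Two symbols guarantee [n]-element sets of strings, so that the height is not [-oo]. With a
     single symbol every output state writes it surely, against [H]. *)
  have [a [c neq_ac]] : exists a c : Sigma, a != c.
    have [a0 _] : exists a0 : Sigma, true.
      apply: contrapT => none; have := muW_split X_star q0.
      rewrite big1 => [/esym/eqP|a _]; first by rewrite oner_eq0.
      by case: none; exists a.
    exists a0; apply: contrapT => none.
    have all_a0 b : b = a0.
      apply/eqP; apply: contrapT => /negP nb; apply: none.
      by exists b; rewrite eq_sym.
    have := H a0 a0; rewrite -(muR_split X_star a0) ltrD2l => /negP; apply.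
    apply/negP; rewrite -leNgt; apply: ler_sum => q _.
    have := muW_split X_star q; rewrite (bigD1 a0) //= big1 ?addr0 => [|b]; last first.
      by rewrite (all_a0 b) eqxx.
    by rewrite addrC => ->; rewrite mulr1.
  have [C HC] := log_bound rho01.
  exists C; exists 2%N => // n /= n_ge2.
  rewrite smoothed_heightE gee0_abs; last first.
    apply: le_trans (ereal_sup_ubound _); last first.
      exists (marked_strings a c 0 n) => //; exact: card_marked_strings.
    by apply: integral_ge0 => om _; exact: max_lcp_ge0.
  have [K leK] := HC n n_ge2.
  apply: ge_ereal_sup => _ [A /= cardA <-].
  apply: le_trans (integral_max_lcp_le X_star X_canonical Y_runs A K rho01 decay) _.
  by rewrite lee_fin cardA.
- rewrite ltNge; apply/negP => H.
  (* A single [n] refutes the bound; it must be at least 2 to provide a pair. *)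
  pose n := maxn N 2.
  have := HC n (leq_maxl _ _); apply/negP; rewrite -ltNge.
  (* Over one symbol there is only one string: the height at [n] is [-oo], of absolute value
     [+oo]. *)
  have [[c neq_ac]|none] := pselect (exists c, a != c); last first.
    rewrite smoothed_heightE [X in ereal_sup X](_ : _ = set0) ?ereal_sup0 ?ltry //.
    apply/seteqP; split=> // _ [A /= cardA _].
    have : (#|` A| <= 1)%fset%N.
      rewrite -(cardfs1 ((fun=> a) : iword Sigma)); apply: fsubset_leq_card.
      apply/fsubsetP => t _; rewrite inE; apply/eqP/funext => i.
      by apply/eqP/negPn/negP => nt; apply: none; exists (t i); rewrite eq_sym.
    by rewrite cardA leqNgt (leq_maxr N 2).
  (* The factor 4 offsets the agreement probability [4^-1], the product of two probabilities of at
     least [2^-1]. *)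
  have [K K_gt] : exists K : nat, 4 * (C * ln n%:R) < K%:R.
    by exists (Num.trunc (4 * (C * ln n%:R))).+1; exact: truncnS_gt.
  (* By [X_del] the base of the power is below 1, so a long enough prefix of [a] makes each run
     begin with [nseq K b] with probability at least [2^-1]. *)
  have [m small] : exists m,
      4 ^+ K * ((1 + muR s a (inl s)) / 2) ^+ m <= 2^-1 :> R.
    set th := _ / 2.
    have th_lt1 : `|th| < 1.
      by rewrite ger0_norm /th ?divr_ge0 ?addr_ge0 ?muR_ge0 //; have := X_del a; lra.
    have eps_gt0 : 0 < 2^-1 / 4 ^+ K :> R by rewrite divr_gt0 ?invr_gt0 ?exprn_gt0.
    have /cvgrPdist_le/(_ _ eps_gt0)[m _ /(_ m (leqnn m))] := cvg_expr th_lt1.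
    rewrite /= sub0r normrN => le_m; exists m.
    rewrite mulrC -ler_pdivlMr ?exprn_gt0 //; exact: le_trans (ler_norm _) le_m.
  have nseq_ge i :
      2^-1 <= written_prob (marked_string a c m i) (inl s) m (prefix (nseq K b)).
    apply: le_trans (written_prob_nseq_ge X_star H K _); first by lra.
    by move=> j; exact: marked_string_prefix.
  apply: lt_le_trans (lee_abs _).
  rewrite smoothed_heightE.
  apply: lt_le_trans (ereal_sup_ubound _); last first.
    by exists (marked_strings a c m n) => //; exact: card_marked_strings.
  have n_ge2 : (1 < n)%N by exact: leq_maxr.
  have neq01 : marked_string a c m 0 != marked_string a c m 1.
    by apply/eqP => /(marked_string_inj neq_ac).
  apply: lt_le_trans (integral_max_lcp_ge Y_runs (k := K) (p := 4^-1) _ _ neq01 _).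
  + by rewrite lte_fin ltr_pdivlMr // mulrC.
  + exact/mem_marked_strings/ltnW.
  + exact: mem_marked_strings.
  have := prob_agree_event_ge X_star X_canonical Y_runs (nseq K b) m neq01.
  rewrite size_nseq; apply: le_trans; rewrite lee_fin.
  have -> : 4^-1 = 2^-1 * 2^-1 :> R by lra.
  by apply: ler_pM => //; rewrite invr_ge0.
Qed.
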